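(* Let $w\ge 1$ and $\epsilon\ge 1$ be the inflation factors of w-ePA*SE. If $w\le\epsilon$, and w-ePA*SE chooses for expansion a dummy edge $e^d=(\mathbf{s},\mathbf{a^d})$ whose source state belongs to the goal region, i.e. $\mathbf{s}\in\mathcal{G}$, then $$g(\mathbf{s})\le\epsilon\, g^*(\mathbf{s})=\epsilon\cdot c^*,$$ where $c^*$ is the optimal cost of a path from the start state $\mathbf{s}_0$ to a state in the goal region $\mathcal{G}$.
   Context: Setting. $G=(\mathcal{V},\mathcal{E})$ is a finite directed graph whose vertices are states. There is a set $\mathcal{A}$ of deterministic actions. An edge is a pair $e=(\mathbf{s},\mathbf{a})$ with source state $e.\mathbf{s}=\mathbf{s}$ and action $\mathbf{a}\in\mathcal{A}$; it leads to a successor state and has cost $c(e)\in[0,\infty]$. $\mathbf{s}_0$ is the start state and $\mathcal{G}$ is the goal region (a set of states). The cost of a path is the sum of its edge costs. $c^*(\mathbf{s},\mathbf{s}')$ is the optimal cost of a path from $\mathbf{s}$ to $\mathbf{s}'$, and $g^*(\mathbf{s})$ is the optimal cost of a path from $\mathbf{s}_0$ to $\mathbf{s}$. Heuristics. The unary heuristic $h(\mathbf{s})$ is consistent and therefore admissible (it never overestimates the cost to the goal). The pairwise heuristic $h(\mathbf{s},\mathbf{s}')$, a different function denoted by the same letter, estimates the cost between any pair of states. It is forward-backward consistent: $h(\mathbf{s},\mathbf{s}'')\le h(\mathbf{s},\mathbf{s}')+h(\mathbf{s}',\mathbf{s}'')$ for all $\mathbf{s},\mathbf{s}',\mathbf{s}''$,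 and $h(\mathbf{s},\mathbf{s}')\le c^*(\mathbf{s},\mathbf{s}')$ for all $\mathbf{s},\mathbf{s}'$. Algorithm w-ePA*SE. It maintains a value $g(\mathbf{s})$ for each state (the cost of the best path from $\mathbf{s}_0$ found so far; initially $g(\mathbf{s}_0)=0$ and $g(\mathbf{s})=\infty$ otherwise), a priority queue $OPEN$ of edges generated but not yet expanded, a set $BE$ of partially expanded states, and a set $CLOSED$ of expanded states. Besides real edges there is, for each state $\mathbf{s}$, a dummy edge $(\mathbf{s},\mathbf{a^d})$, a placeholder for all real edges out of $\mathbf{s}$. The priority of a (real or dummy) edge $e$ in $OPEN$ is $f(e)=g(e.\mathbf{s})+w\,h(e.\mathbf{s})$. Initially $OPEN$ contains only $(\mathbf{s}_0,\mathbf{a^d})$, and $BE$ and $CLOSED$ are empty. Independence checks. An edge $e\in OPEN$ is safe to expand if (i) $g(e.\mathbf{s})-g(e'.\mathbf{s})\le\epsilon\,h(e'.\mathbf{s},e.\mathbf{s})$ for all $e'\in OPEN$ with $f(e')<f(e)$, and (ii) $g(e.\mathbf{s})-g(\mathbf{s}')\le\epsilon\,h(\mathbf{s}',e.\mathbf{s})$ for all $\mathbf{s}'\in BE$. Main loop. A main thread repeatedly chooses for expansion, and removes from $OPEN$, an edge of smallest priority among those in $OPEN$ that are safe to expand; if there is none, it waits until $OPEN$ or $BE$ changes. If the source state of the chosen edge lies in $\mathcal{G}$, the algorithm terminates and returns the path found to that state; otherwise the edge is assigned to one of $N_t$ expansion threads, which run in parallel. If $OPEN$ and $BE$ are both empty,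 the algorithm terminates without a solution. Accesses to the shared data are made under a lock; only edge evaluation is done outside the lock. Expanding a dummy edge $(\mathbf{s},\mathbf{a^d})$: insert $\mathbf{s}$ in $BE$ and insert all real edges $(\mathbf{s},\mathbf{a})$, $\mathbf{a}\in\mathcal{A}$, in $OPEN$. A state is considered partially expanded, and so belongs to $BE$, once its dummy edge is under expansion or expanded, until all of its outgoing real edges have been expanded. Expanding a real edge $(\mathbf{s},\mathbf{a})$: evaluate it to obtain its successor $\mathbf{s}'$ and $c((\mathbf{s},\mathbf{a}))$; then, if $\mathbf{s}'\notin CLOSED\cup BE$ and $g(\mathbf{s}')>g(\mathbf{s})+c((\mathbf{s},\mathbf{a}))$, set $g(\mathbf{s}')=g(\mathbf{s})+c((\mathbf{s},\mathbf{a}))$ and insert the dummy edge $(\mathbf{s}',\mathbf{a^d})$ in $OPEN$ (or update its priority if it is already there). Then, if all real edges out of $\mathbf{s}$ have been expanded, move $\mathbf{s}$ from $BE$ to $CLOSED$.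
   Formalization: The bound g(s) ≤ ε g*(s) is stated for every goal region; the equality ε g*(s) = ε c* is stated only when no goal state has a smaller g* than s (e.g. a single goal state), since with several goal states w-ePA*SE may choose a non-optimal goal state and the equality then fails. *)

(* Defs.v *)
From mathcomp Require Import all_boot all_order all_algebra.
From mathcomp Require Import all_classical all_reals all_analysis.

Set Implicit Arguments.
Unset Strict Implicit.
Unset Printing Implicit Defensive.

Import Order.TTheory GRing.Theory Num.Theory.
Local Open Scope ereal_scope.

Record search_problem (R : realType) := SearchProblem {
  state : finType;
  action : finType;
  edges : {set state * action};
  succ : state * action -> state;
  cost : state * action -> \bar R;
  cost_ge0 : forall e, e \in edges -> 0 <= cost e;
  start : state;
  goal : {set state}
}.

Section Graph.
Context {R : realType}.
Variable P : search_problem R.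
Local Notation S := (state P).
Local Notation A := (action P).

Fixpoint is_path (s : S) (p : seq (S * A)) (t : S) : bool :=
  if p is e :: p' then [&& e.1 == s, e \in edges P & is_path (succ e) p' t]
  else s == t.

Definition path_cost (p : seq (S * A)) : \bar R := \sum_(e <- p) cost e.

(* +oo when there is no path *)
Definition optcost (s t : S) : \bar R :=
  ereal_inf [set path_cost p | p in [set p | is_path s p t]]%classic.

Definition gstar (s : S) : \bar R := optcost (start P) s.

Definition goal_optcost : \bar R :=
  ereal_inf [set path_cost p | p in
    [set p | exists2 t, t \in goal P & is_path (start P) p t]]%classic.

(* Heuristic values lie in ]-oo, +oo]. *)
Definition consistent (h : S -> \bar R) : Prop :=
  [/\ forall s, -oo < h s,
      forall t, t \in goal P -> h t = 0
    & forall e, e \in edges P -> h e.1 <= cost e + h (succ e)].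

Definition fb_consistent (hp : S -> S -> \bar R) : Prop :=
  [/\ forall s t, -oo < hp s t,
      forall s s' s'', hp s s'' <= hp s s' + hp s' s''
    & forall s s', hp s s' <= optcost s s'].

(* The algorithm handles elements of S * option A: [(s, Some a)] is the real
   edge (s, a) and [(s, None)] is the dummy edge of s. *)
Definition real_edges (s : S) : {set S * option A} :=
  [set (s, Some a) | a in [pred a | (s, a) \in edges P]].

End Graph.

Section Algorithm.
Context {R : realType}.
Variable P : search_problem R.
Variable Nt : nat.
Local Notation S := (state P).
Local Notation A := (action P).

(* [held] is the edge that the main thread has chosen and not yet handed over
   to an expansion thread, [threads i] is the edge that thread i is currently
   expanding, and [expanded] is the set of the real edges whose expansion is
   complete.  Priorities are not stored: they are a function of [gval]. *)
Record config := Config {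
  gval : S -> \bar R;
  OPEN : {set S * option A};
  BE : {set S};
  CLOSED : {set S};
  expanded : {set S * A};
  held : option (S * option A);
  threads : {ffun 'I_Nt -> option (S * option A)}
}.

Definition init_config : config :=
  Config (fun s => if s == start P then 0 else +oo) [set (start P, None)]
    finset.set0 finset.set0 finset.set0 None [ffun=> None].

Definition set_thread (th : {ffun 'I_Nt -> option (S * option A)})
    (i : 'I_Nt) (x : option (S * option A)) :=
  [ffun j => if j == i then x else th j].

(* Effect of choosing e.  A state is partially expanded as soon as its dummy
   edge is under expansion, so it enters BE in the same atomic step in which
   its dummy edge leaves OPEN. *)
Definition take_edge (K : config) (e : S * option A) : config :=
  Config (gval K) (OPEN K :\ e)
    (if e.2 is None then e.1 |: BE K else BE K)
    (CLOSED K) (expanded K) (Some e) (threads K).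

Definition assign_edge (K : config) (i : 'I_Nt) (e : S * option A) : config :=
  Config (gval K) (OPEN K) (BE K) (CLOSED K) (expanded K)
    None (set_thread (threads K) i (Some e)).

Definition close_if_done (K : config) (s : S) : config :=
  if [forall a, ((s, a) \in edges P) ==> ((s, a) \in expanded K)] then
    Config (gval K) (OPEN K) (BE K :\ s) (s |: CLOSED K) (expanded K)
      (held K) (threads K)
  else K.

(* [close_if_done] only matters here for a state without outgoing edges. *)
Definition expand_dummy (K : config) (i : 'I_Nt) (s : S) : config :=
  close_if_done
    (Config (gval K) (OPEN K :|: real_edges s) (BE K) (CLOSED K) (expanded K)
       (held K) (set_thread (threads K) i None))
    s.

Definition expand_real (K : config) (i : 'I_Nt) (s : S) (a : A) : config :=
  let s' := succ (s, a) in
  let v := gval K s + cost (s, a) in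
  let upd := (s' \notin CLOSED K :|: BE K) && (v < gval K s') in
  close_if_done
    (Config (fun t => if upd && (t == s') then v else gval K t)
       (if upd then (s', None) |: OPEN K else OPEN K)
       (BE K) (CLOSED K) ((s, a) |: expanded K)
       (held K) (set_thread (threads K) i None))
    s.

Variable h : S -> \bar R.
Variable hp : S -> S -> \bar R.
Variables w eps : R.

Definition prio (K : config) (e : S * option A) : \bar R :=
  gval K e.1 + w%:E * h e.1.

(* The g-values of the sources of edges in OPEN and of the states in BE are
   finite in every reachable configuration, so the differences below never
   have the form +oo - +oo. *)
Definition safe (K : config) (e : S * option A) : Prop :=
  (forall e', e' \in OPEN K -> prio K e' < prio K e ->
     gval K e.1 - gval K e'.1 <= eps%:E * hp e'.1 e.1) /\
  (forall s', s' \in BE K ->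
     gval K e.1 - gval K s' <= eps%:E * hp s' e.1).

Definition chooses (K : config) (e : S * option A) : Prop :=
  [/\ held K = None, e \in OPEN K, safe K e
    & forall e', e' \in OPEN K -> safe K e' -> prio K e <= prio K e'].

(* Interleaving semantics: every constructor is one critical section.  There
   is no step after an edge with source in the goal region has been chosen,
   since the algorithm then terminates.  The evaluation of a real edge takes
   place outside the lock, between [step_assign] and [step_real]. *)
Inductive step (K : config) : config -> Prop :=
| step_choose e of chooses K e & e.1 \notin goal P :
    step K (take_edge K e)
| step_assign i e of held K = Some e & threads K i = None :
    step K (assign_edge K i e)
| step_dummy i s of threads K i = Some (s, None) :
    step K (expand_dummy K i s)
| step_real i s a of threads K i = Some (s, Some a) :
    step K (expand_real K i s a).

Inductive reachable : config -> Prop :=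
| reachable_init : reachable init_config
| reachable_step K K' of reachable K & step K K' : reachable K'.

End Algorithm.

(* Main.v *)
(* Let v be the first state outside CLOSED on a path from the start to a state
   s whose dummy edge is chosen.  Its predecessor on the path is fully expanded
   and its g-value is within the factor eps, hence so is g v.  If v is in BE, or
   if its dummy edge is in OPEN with a priority smaller than that of s, then the
   independence check bounds g s - g v by eps times the cost of the remaining
   path; if the priority of v is at least that of s, then consistency of h and
   w <= eps do.  The g-values of partially expanded and expanded states no
   longer change, so the bound persists.  The bound is claimed only where h is
   finite: two edges of infinite priority are not ordered by their g-values. *)
Require Import Defs.
From mathcomp Require Import all_boot all_order all_algebra.
From mathcomp Require Import all_classical all_reals all_analysis.
From mathcomp Require Import lra.

Set Implicit Arguments.
Unset Strict Implicit.
Unset Printing Implicit Defensive.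

Import Order.TTheory GRing.Theory Num.Theory.
Local Open Scope ereal_scope.

(** * Costs and optimal costs of paths *)

Section Paths.
Context {R : realType} {P : search_problem R}.
Implicit Types (s t u : state P) (p q : seq (state P * action P)).

Lemma is_path_cat s p q t u :
  is_path s p t -> is_path t q u -> is_path s (p ++ q) u.
Proof.
elim: p s => [s /eqP->//|e p IHp s /= /and3P[-> -> ?] ?] /=.
exact: IHp.
Qed.

Lemma path_cost_nil : path_cost (Nil (state P * action P)) = 0.
Proof. by rewrite /path_cost big_nil. Qed.

Lemma path_cost_cons e p : path_cost (e :: p) = cost e + path_cost p.
Proof. by rewrite /path_cost big_cons. Qed.

Lemma path_cost_cat p q : path_cost (p ++ q) = path_cost p + path_cost q.
Proof. by rewrite /path_cost big_cat. Qed.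

Lemma path_cost_ge0 s p t : is_path s p t -> 0 <= path_cost p.
Proof.
elim: p s => [s _|e p IHp s /= /and3P[_ eE /IHp p0]].
  by rewrite path_cost_nil.
by rewrite path_cost_cons adde_ge0 // cost_ge0.
Qed.

Lemma optcost_le s p t : is_path s p t -> optcost s t <= path_cost p.
Proof. by move=> sp; apply: ereal_inf_lbound; exists p. Qed.

Lemma consistent_path (h : state P -> \bar R) s p t :
  consistent h -> is_path s p t -> h s <= path_cost p + h t.
Proof.
move=> [_ _ hE]; elim: p s => [s /eqP->|e p IHp s /=].
  by rewrite path_cost_nil add0e.
case/and3P=> /eqP<- eE /IHp hp; rewrite path_cost_cons -addeA.
by apply: le_trans (hE _ eE) _; rewrite leeD2l.
Qed.

(** For an arbitrary goal state only [goal_optcost P <= gstar s] holds; minimality of [gstar s]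
    among the goal states gives the converse. *)
Lemma goal_optcost_gstar s : s \in goal P ->
  (forall t, t \in goal P -> gstar s <= gstar t) -> gstar s = goal_optcost P.
Proof.
move=> sG smin; apply/eqP; rewrite eq_le; apply/andP; split.
  apply/ereal_infP => _ [p [t tG sp] <-].
  exact: le_trans (smin t tG) (optcost_le sp).
apply/ereal_infP => _ [p sp <-]; apply: ereal_inf_lbound.
by exists p => //; exists s.
Qed.

End Paths.

(** * The invariant of reachable configurations *)

Section Invariant.
Context {R : realType} {P : search_problem R}.
Variables (h : state P -> \bar R) (hp : state P -> state P -> \bar R).
Variables (w eps : R) (Nt : nat).
Hypotheses (w1 : (1 <= w)%R) (weps : (w <= eps)%R).
Hypotheses (hcons : consistent h) (hpcons : fb_consistent hp).
Local Notation config := (config P Nt).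
Implicit Types (K : config) (s t u : state P).

Let w0 : (0 < w)%R. Proof. exact: lt_le_trans w1. Qed.
Let eps0 : (0 < eps)%R. Proof. exact: lt_le_trans weps. Qed.
Let eps1 : (1 <= eps)%R. Proof. exact: le_trans weps. Qed.

Definition visited K : {set state P} := CLOSED K :|: BE K.

(** Leaves out only the dummy edges in [OPEN]: under the invariant, their sources are unvisited,
    whereas the source of a pending edge is visited. *)
Definition pending K (e : state P * option (action P)) : Prop :=
  [\/ held K = Some e, exists i, threads K i = Some e
    | e \in OPEN K /\ e.2 <> None].

(** [gval_bound] speaks of single paths rather than of [gstar], so that it applies directly to
    prefixes of a given path. [expanded_gval] is restricted to unvisited successors because a
    visited state keeps its g-value even when a cheaper path to it is found; there [gval_bound]
    takes over. *)
Record invariant K : Prop := Invariant {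
  gval_ge0 : forall t, 0 <= gval K t;
  gval_start : gval K (start P) <= 0;
  gval_lty : forall t,
    (gval K t < +oo) = (t \in visited K) || ((t, None) \in OPEN K);
  dummy_unvisited : forall t, (t, None) \in OPEN K -> t \notin visited K;
  pending_visited : forall e, pending K e -> e.1 \in visited K;
  pending_edge : forall s a, pending K (s, Some a) -> (s, a) \in edges P;
  closed_expanded : forall s a,
    s \in CLOSED K -> (s, a) \in edges P -> (s, a) \in expanded K;
  expanded_visited : forall e, e \in expanded K -> e.1 \in visited K;
  expanded_gval : forall e, e \in expanded K -> succ e \notin visited K ->
    gval K (succ e) <= gval K e.1 + cost e;
  gval_bound : forall s q, s \in visited K -> h s < +oo ->
    is_path (start P) q s -> gval K s <= eps%:E * path_cost q
}.

(** * The bound on the g-value of a chosen dummy edge *)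

Lemma chosen_gval_frontier K s u p : invariant K ->
  chooses h hp w eps K (s, None) -> h s < +oo ->
  gval K u < +oo -> u \notin CLOSED K -> is_path u p s ->
  path_cost p < +oo -> gval K s <= gval K u + eps%:E * path_cost p.
Proof.
move=> IK [_ sO [safeO safeB] _] hs gu uC up py.
have gsf : gval K s \is a fin_num.
  by rewrite ge0_fin_numE ?gval_ge0// gval_lty// sO orbT.
have guf : gval K u \is a fin_num by rewrite ge0_fin_numE ?gval_ge0.
(* Either half of the independence check supplies this premise, and [hp u s] is at most the cost of
   [p]. *)
have safe_le : gval K s - gval K u <= eps%:E * hp u s ->
    gval K s <= gval K u + eps%:E * path_cost p.
  rewrite leeBlDl// => /le_trans; apply; rewrite leeD2l// lee_pmul2l//.
  have [_ _ hpo] := hpcons.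
  exact: le_trans (hpo u s) (optcost_le up).
move: gu; rewrite gval_lty// !inE (negbTE uC)/= => /orP[uB|uO].
  exact/safe_le/safeB.
have [lt_us|] := ltP (prio h w K (u, None)) (prio h w K (s, None)).
  exact/safe_le/(safeO _ uO).
(* Now g(s) + w h(s) <= g(u) + w h(u). Consistency along [p] gives h(u) <= cost(p) + h(s), which
   makes h(u) finite and yields g(s) <= g(u) + w cost(p). *)
rewrite /prio/=; have [hgt _ _] := hcons.
have := consistent_path hcons up; have := path_cost_ge0 up.
move: (hgt s) (hgt u) hs gsf guf py.
case: (h s) => // hs; case: (gval K s) => // gs; case: (gval K u) => // gu.
case: (path_cost p) => // c; case: (h u) => // hu _ _ _ _ _ _.
rewrite -!EFinM -!EFinD !lee_fin => c0 huc gle.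
have : (w * hu <= w * (c + hs))%R by rewrite ler_pM2l.
have : (w * c <= eps * c)%R by rewrite ler_wpM2r.
by rewrite mulrDr; lra.
Qed.

Lemma chosen_gval_bound K s q : invariant K ->
  chooses h hp w eps K (s, None) -> h s < +oo ->
  is_path (start P) q s -> gval K s <= eps%:E * path_cost q.
Proof.
move=> IK Kch hs.
(* Walk along the path: [r] is the part already passed, [u] its end, and the bound on g(u) is
   carried along until [u] is outside [CLOSED]. *)
suff key p r u : is_path (start P) r u -> is_path u p s ->
    gval K u <= eps%:E * path_cost r -> gval K s <= eps%:E * path_cost (r ++ p).
  move=> /(key q [::] (start P)); apply => //=.
  by rewrite path_cost_nil mule0 gval_start.
elim: p r u => [r u _ /eqP-> gs|e p IHp r u ru uep gu]; first by rewrite cats0.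
have r0 := path_cost_ge0 ru; have ep0 := path_cost_ge0 uep.
(* For a path of infinite cost the right-hand side is infinite, as [eps] is positive. *)
have [] := ltP (path_cost (r ++ e :: p)) +oo; last first.
  by rewrite leye_eq => /eqP->; rewrite gt0_muley ?lte_fin ?leey.
rewrite path_cost_cat => rep.
have ry : path_cost r < +oo by apply: le_lt_trans rep; rewrite leeDl.
have epy : path_cost (e :: p) < +oo by apply: le_lt_trans rep; rewrite leeDr.
have guy : gval K u < +oo.
  apply: le_lt_trans gu _; by rewrite lte_mul_pinfty ?lee_fin ?ltW.
have [uC|uC] := boolP (u \in CLOSED K); last first.
  apply: le_trans (chosen_gval_frontier IK Kch hs guy uC uep epy) _.
  by rewrite ge0_muleDr// leeD2r.
case/and3P: (uep) => /eqP e1u eE vp.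
have c0 := cost_ge0 eE; have p0 := path_cost_ge0 vp.
have rv : is_path (start P) (rcons r e) (succ e).
  by rewrite -cats1; apply: is_path_cat ru _; rewrite /= e1u eE !eqxx.
have eX : e \in expanded K.
  by case: (e) e1u eE => [u' a] /= -> ?; apply: closed_expanded.
rewrite -path_cost_cat -cat_rcons; apply: (IHp _ (succ e)) => //.
(* A visited successor v is bounded by the invariant, since consistency along the remaining path
   makes h(v) finite. An unvisited one satisfies g(v) <= g(u) + c(e), and c(e) <= eps c(e). *)
have [vV|vV] := boolP (succ e \in visited K).
  apply: gval_bound => //; apply: le_lt_trans (consistent_path hcons vp) _.
  apply: lte_add_pinfty => //; apply: le_lt_trans epy.
  by rewrite path_cost_cons leeDr.
apply: le_trans (expanded_gval IK eX vV) _.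
rewrite e1u -cats1 path_cost_cat path_cost_cons path_cost_nil adde0.
by rewrite ge0_muleDr// leeD// lee_pemull.
Qed.

(** * The invariant holds initially and is preserved by every step *)

Lemma invariant_init : invariant (init_config P Nt).
Proof.
have V0 : visited (init_config P Nt) = finset.set0 by rewrite /visited finset.setU0.
split; rewrite ?V0 /=.
- by move=> t; case: ifP; rewrite ?lexx ?leey.
- by rewrite eqxx lexx.
- by move=> t; rewrite !inE xpair_eqE andbT; case: ifP; rewrite ?ltry ?ltxx.
- by move=> t _; rewrite inE.
- by move=> e [//|[i]|[]]; rewrite /= ?ffunE ?inE// => /eqP->.
- by move=> s a [//|[i]|[]]; rewrite /= ?ffunE ?inE// => /eqP.
- by move=> s a; rewrite inE.
- by move=> e; rewrite inE.
- by move=> e; rewrite inE.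
- by move=> s q; rewrite inE.
Qed.

(** Moving [s] from [BE] to [CLOSED] leaves the visited set unchanged, so only [closed_expanded] is
    at stake, and the guard provides it. *)
Lemma invariant_close K s : invariant K -> s \in visited K ->
  invariant (close_if_done K s).
Proof.
move=> IK sV; rewrite /close_if_done; case: ifP => // /forallP sdone.
set K' := Config _ _ _ _ _ _ _.
have VE : visited K' = visited K.
  apply/setP => t; rewrite !inE; case: eqP => [->|]//=.
  by move: sV; rewrite !inE.
case: IK => *; split; rewrite ?VE//.
move=> t a; rewrite /K' /= !inE => /orP[/eqP-> saE|]; last by auto.
exact: (implyP (sdone a)).
Qed.

(** Only this step makes a state visited, so only here does [gval_bound] need the independence
    check. *)
Lemma invariant_choose K e : invariant K -> chooses h hp w eps K e ->
  invariant (take_edge K e).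
Proof.
move=> IK Kch; have [_ eO _ _] := Kch.
have VE t : (t \in visited (take_edge K e)) =
    (t \in visited K) || ((e.2 == None) && (t == e.1)).
  rewrite !inE; case: e {Kch eO} => s [a|] /=; first by rewrite orbF.
  by rewrite !inE orbCA orbC.
have sub t : t \in visited K -> t \in visited (take_edge K e).
  by rewrite VE => ->.
have pend e' : pending (take_edge K e) e' -> e' = e \/ pending K e'.
  case=> [[->]|eT|[]]; [by left|by right; constructor 2|].
  by rewrite /= !inE => /andP[_ ?] ?; right; constructor 3.
split.
- exact: (gval_ge0 IK).
- exact: (gval_start IK).
- move=> t; rewrite VE /= !inE (gval_lty IK) !inE.
  case: e {VE sub pend Kch} eO => s [a|] /= eO.
    by rewrite !xpair_eqE !andbF orbF.
  rewrite xpair_eqE andbT; case: eqP => [->|_]; last by rewrite orbF.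
  by rewrite eO !orbT.
- move=> t /=; rewrite in_setD1 VE negb_or => /andP[te tO].
  rewrite (dummy_unvisited IK tO)/=; apply: contra te => /andP[/eqP eN /eqP->].
  by rewrite -eN -surjective_pairing.
- move=> e' /pend[->|]; last by move=> /(pending_visited IK)/sub.
  rewrite VE; case: eqP => [_|eN]; first by rewrite eqxx orbT.
  by rewrite (pending_visited IK)//; constructor 3.
- move=> s a /pend[ea|]; last exact: (pending_edge IK).
  by apply: (pending_edge IK); constructor 3; split=> //; rewrite ea.
- exact: (closed_expanded (K := K) IK).
- by move=> e' /(expanded_visited IK)/sub.
- by move=> e' eX /(contra (@sub _))/(expanded_gval IK eX).
- move=> t q; rewrite VE => /orP[|/andP[/eqP e2 /eqP te]].
    exact: (gval_bound (K := K) IK).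
  apply: (chosen_gval_bound (K := K)) => //.
  by rewrite te -e2 -surjective_pairing.
Qed.

Lemma invariant_assign K i e : invariant K -> held K = Some e ->
  invariant (assign_edge K i e).
Proof.
move=> IK Ke.
have pend e' : pending (assign_edge K i e) e' -> pending K e'.
  case=> [//|[j]|eO]; last by constructor 3.
  rewrite /= ffunE; case: ifP => _ je; first by constructor 1; rewrite Ke.
  by constructor 2; exists j.
case: IK => ? ? ? ? pv pe *; split=> //.
- by move=> e' /pend/pv.
- by move=> s a /pend/pe.
Qed.

Lemma invariant_dummy K i s : invariant K -> threads K i = Some (s, None) ->
  invariant (expand_dummy K i s).
Proof.
move=> IK Ki; have sV : s \in visited K.
  by apply: (pending_visited IK (e := (s, None))); constructor 2; exists i.
apply: invariant_close => //; set K' := Config _ _ _ _ _ _ _.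
have OE t : ((t, None) \in OPEN K') = ((t, None) \in OPEN K).
  by rewrite /K' /= inE; apply/orb_idr => /imsetP[a].
have pend e : pending K' e ->
    pending K e \/ exists2 a, (s, a) \in edges P & e = (s, Some a).
  case=> [eh|[j]|[]]; first by left; constructor 1.
    rewrite /= ffunE; case: ifP => // _ je.
    by left; constructor 2; exists j.
  rewrite /K' /= inE => /orP[eO eN|/imsetP[a saE ->] _].
    by left; constructor 3.
  by right; exists a.
case: IK => ? ? gy du pv pe *; split=> //.
- by move=> t; rewrite OE gy.
- by move=> t; rewrite OE => /du.
- by move=> e /pend[/pv//|[a _ ->]].
- by move=> t a /pend[/pe//|[b sbE [-> ->]]].
Qed.

(** An update only lowers g-values, and only that of an unvisited state; the source of every
    expanded edge is visited, so its g-value is frozen. *)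
Lemma invariant_real K i s a : invariant K ->
  threads K i = Some (s, Some a) -> invariant (expand_real K i s a).
Proof.
move=> IK Ki.
have sap : pending K (s, Some a) by constructor 2; exists i.
have sV : s \in visited K := pending_visited IK sap.
have saE := pending_edge IK sap.
rewrite /expand_real; set v := gval K s + _; set upd := _ && _.
apply: invariant_close => //; set K' := Config _ _ _ _ _ _ _.
have v0 : 0 <= v by rewrite adde_ge0 ?cost_ge0 ?gval_ge0.
have gle t : gval K' t <= gval K t.
  by rewrite /K' /=; case: ifP => // /andP[/andP[_ /ltW vle] /eqP->].
have gV t : t \in visited K -> gval K' t = gval K t.
  move=> tV; rewrite /K' /=; case: ifP => // /andP[/andP[+ _] /eqP ts].
  by rewrite -ts -/(visited K) tV.
have pend e : pending K' e -> pending K e.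
  case=> [eh|[j]|[]]; first by constructor 1.
    by rewrite /= ffunE; case: ifP => // _ je; constructor 2; exists j.
  rewrite /K' /=; case: ifP => _; last by constructor 3.
  by rewrite !inE => /orP[/eqP->//|]; constructor 3.
split.
- by move=> t; rewrite /K' /=; case: ifP => // _; exact: gval_ge0.
- exact: le_trans (gle _) (gval_start IK).
- move=> t; rewrite /K' /=; have [/andP[sV' vs]|_] := boolP upd => /=; last first.
    exact: gval_lty.
  (* The updated state enters [OPEN], and its new value is finite because it is strictly below the
     old one. *)
  rewrite !inE xpair_eqE andbT; case: eqP => _ /=.
    by rewrite orbT (lt_le_trans vs) ?leey.
  by rewrite gval_lty// !inE.
- move=> t; rewrite /K' /=; case: ifP => [/andP[sV' _]|_]; last first.
    exact: dummy_unvisited.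
  by rewrite !inE xpair_eqE andbT => /orP[/eqP->|/(dummy_unvisited IK)]//;
    move: sV'; rewrite !inE.
- by move=> e /pend/(pending_visited IK).
- by move=> t b /pend/(pending_edge IK).
- move=> t b tC tbE; rewrite /K' /= inE.
  by rewrite (closed_expanded IK tC tbE) orbT.
- by move=> e; rewrite /K' /= !inE => /orP[/eqP->//|/(expanded_visited IK)];
    move: sV; rewrite !inE.
- move=> e eX eV; rewrite (gV e.1); last first.
    move: eX; rewrite /K' /= in_setU1.
    by move=> /orP[/eqP->//|/(expanded_visited IK)].
  (* For the edge just expanded, either the update gives equality or, its successor being unvisited,
     it failed because the old value was already small enough. *)
  move: eX; rewrite /K' in_setU1 => /orP[/eqP ee|eX].
    rewrite ee /= eqxx andbT; case: ifP => //.
    rewrite /upd -/(visited K) -ee (eV : succ e \notin visited K) /= ee.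
    by move=> /negbT; rewrite -leNgt.
  by apply: le_trans (gle _) _; apply: (expanded_gval IK eX).
- by move=> t q tV; rewrite gV//; apply: gval_bound.
Qed.

Lemma reachable_invariant K : reachable h hp w eps K -> invariant K.
Proof.
elim=> [|{}K K' _ IK]; first exact: invariant_init.
case=> [e Kch _|i e Ke _|i s|i s a].
- exact: invariant_choose.
- exact: invariant_assign.
- exact: invariant_dummy.
- exact: invariant_real.
Qed.

Lemma reachable_gval_gstar K s : reachable h hp w eps K ->
  chooses h hp w eps K (s, None) -> h s < +oo ->
  gval K s <= eps%:E * gstar s.
Proof.
move=> /reachable_invariant IK Kch hs.
(* Dividing by [eps] exposes the infimum [gstar s], so that one path at a time suffices. *)
rewrite -lee_pdivrMl//; apply/ereal_infP => _ [q sq <-].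
by rewrite lee_pdivrMl//; apply: chosen_gval_bound.
Qed.

End Invariant.

Theorem theorem3 (R : realType) (P : search_problem R)
  (h : state P -> \bar R) (hp : state P -> state P -> \bar R)
  (w eps : R) (Nt : nat) (K : config P Nt) (s : state P)
  (hw : (1 <= w)%R) (heps : (1 <= eps)%R)
  (hcons : consistent h) (hpcons : fb_consistent hp)
  (hweps : (w <= eps)%R)
  (Kreach : reachable h hp w eps K)
  (Kchoose : chooses h hp w eps K (s, None))
  (sgoal : s \in goal P) :
  (gval K s <= eps%:E * gstar s)%E /\
  ((forall t, t \in goal P -> (gstar s <= gstar t)%E) ->
   (eps%:E * gstar s = eps%:E * goal_optcost P)%E).
Proof.
split; last by move=> /(goal_optcost_gstar sgoal)->.
apply: (reachable_gval_gstar hw hweps hcons hpcons Kreach Kchoose).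
(* The heuristic vanishes on the goal region, hence is finite at [s]. *)
by have [_ hG _] := hcons; rewrite hG.
Qed.
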